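(* Let $R$ be a Baer $*$-ring. For any pair $(x,y)$ of arbitrary elements in $R$ there are unique projections $p,q\in\{x,y\}'$ with $p\le q$ such that: (i) $(px,py)$ doubly commute; (ii) $(q(1-p)x,q(1-p)y)$ are compatible and completely non doubly commuting; (iii) $((1-q)x,(1-q)y)$ is completely non compatible.
   Context: A Baer $*$-ring is a ring $R$ with unity $1$ and an involution $*$ such that the right annihilator of every subset of $R$ is a principal right ideal generated by a projection (self-adjoint idempotent). Projections are ordered by $p\le q$ iff $pq=p$. For $x\in R$, $[x]$ denotes the left projection of $x$: the smallest projection $e$ with $ex=x$. For $T\subset R$, $T'$ is the commutant of $T$. A pair $(x,y)$ doubly commutes if $x$ commutes with both $y$ and $y^*$. A pair $(x,y)$ is compatible if $[x^m][y^n]=[y^n][x^m]$ for all $m,n\ge 1$. For a projection $e$ commuting with $x,y$, the compressions $ex,ey$ are regarded as elements of the corner $eRe$ (with unity $e$). The pair $(ex,ey)$ is completely non doubly commuting (respectively completely non compatible) if for every nonzero projection $r\le e$ commuting with $ex$ and $ey$, the pair $(rx,ry)$ does not doubly commute (respectively is not compatible). *)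

(* Defs.v *)
From HB Require Import structures.
From mathcomp Require Import all_boot all_order all_algebra.
From mathcomp Require Import boolp classical_sets.

Set Implicit Arguments.
Unset Strict Implicit.
Unset Printing Implicit Defensive.

Import GRing.Theory.
Local Open Scope ring_scope.
Local Open Scope classical_set_scope.

Record involution (R : pzRingType) (star : R -> R) : Prop := Involution {
  involution_invol : forall x, star (star x) = x;
  involution_add : forall x y, star (x + y) = star x + star y;
  involution_mul : forall x y, star (x * y) = star y * star x
}.

Definition projection (R : pzRingType) (star : R -> R) (e : R) : Prop :=
  e * e = e /\ star e = e.

Definition proj_le (R : pzRingType) (p q : R) : Prop := p * q = p.

Definition right_annihilator (R : pzRingType) (S : set R) : set R :=
  [set a | forall s, S s -> s * a = 0].

Definition principal_right_ideal (R : pzRingType) (e : R) : set R :=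
  [set e * a | a in [set: R]].

(* The zero ring is allowed, as are the zero corners below. *)
Record baer_star_ring (R : pzRingType) (star : R -> R) : Prop := BaerStarRing {
  baer_involution : involution star;
  baer_annihilator : forall S : set R, exists e : R,
    projection star e /\ right_annihilator S = principal_right_ideal e
}.

Definition commutant (R : pzRingType) (T : set R) : set R :=
  [set a | forall t, T t -> GRing.comm a t].

Definition corner (R : pzRingType) (e : R) : set R :=
  [set e * a * e | a in [set: R]].

Definition is_left_projection (R : pzRingType) (star : R -> R) (e x f : R) :
    Prop :=
  [/\ projection star f, corner e f, f * x = x &
      forall g, projection star g -> corner e g -> g * x = x -> proj_le f g].

(* The left projection [x] computed in the *-ring e R e, for x in e R e; the
   whole ring is the case e = 1. The default value 0 is irrelevant in a Baer
   *-ring, where e R e is again Baer and [x] exists. *)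
Definition left_projection (R : pzRingType) (star : R -> R) (e x : R) : R :=
  xget 0 [set f | is_left_projection star e x f].

Definition doubly_commute (R : pzRingType) (star : R -> R) (x y : R) : Prop :=
  GRing.comm x y /\ GRing.comm x (star y).

(* Compatibility of x and y as elements of e R e. Since the exponents are
   positive, powers in e R e agree with powers in R. *)
Definition compatible (R : pzRingType) (star : R -> R) (e x y : R) : Prop :=
  forall m n : nat, (0 < m)%N -> (0 < n)%N ->
    GRing.comm (left_projection star e (x ^+ m))
               (left_projection star e (y ^+ n)).

(* Both notions below concern the pair (e x, e y) in e R e; x and y are the
   uncompressed elements of R. *)
Definition completely_non_doubly_commuting (R : pzRingType) (star : R -> R)
    (e x y : R) : Prop :=
  forall r : R, projection star r -> r <> 0 -> proj_le r e ->
    GRing.comm r (e * x) -> GRing.comm r (e * y) ->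
    ~ doubly_commute star (r * x) (r * y).

Definition completely_non_compatible (R : pzRingType) (star : R -> R)
    (e x y : R) : Prop :=
  forall r : R, projection star r -> r <> 0 -> proj_le r e ->
    GRing.comm r (e * x) -> GRing.comm r (e * y) ->
    ~ compatible star r (r * x) (r * y).

(* Main.v *)
Require Import Defs.
From HB Require Import structures.
From mathcomp Require Import all_boot all_order all_algebra.
From mathcomp Require Import boolp classical_sets.

(** Let A be the set of elements commuting with x, y and their adjoints; the
    projections of {x, y}' are exactly those of A.  For a projection r of A,
    both properties of the pair (r x, r y) are annihilation conditions:
    - it doubly commutes iff r kills x y - y x and x y^* - y^* x;
    - it is compatible iff r kills every commutator of a left projection
      [x^m] with a left projection [y^n], because [r x^m] computed in r R r
      is r [x^m] ([left_projection_compress]).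
    All these obstructions lie in the commutant A' of A.

    For any set C contained in A', the elements of A that kill C form a
    two-sided ideal of A, and the Baer condition shows that this ideal is
    generated by a projection which is central in A ([largest_annihilator]).
    Applied to the two families of obstructions, this gives p and q as the
    largest projections of {x, y}' for which the compressed pair doubly
    commutes, respectively is compatible.  Double commutation implies
    compatibility, so p <= q, and the two complete negations follow from
    maximality.

    For uniqueness, let (p', q') be another solution.  Centrality makes
    p (1 - q') a projection; its compression doubly commutes, hence is
    compatible, so it vanishes by (iii) for (p', q').  Hence p <= q', and
    p - p' = p (1 - p') vanishes by (ii).  Once p = p', the projection q'
    kills the obstructions to compatibility piecewise on p and q' (1 - p), so
    q' <= q, and q (1 - q') vanishes by (iii). *)

Set Implicit Arguments.
Unset Strict Implicit.
Unset Printing Implicit Defensive.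

Import GRing.Theory.
Local Open Scope ring_scope.
Local Open Scope classical_set_scope.

(** * Projections in a Baer *-ring *)

Lemma mulr_compl_eq0 (R : pzRingType) (a b : R) :
  a * (1 - b) = 0 -> a * b = a.
Proof. by rewrite mulrBr mulr1 => /eqP; rewrite subr_eq0 eq_sym => /eqP. Qed.

Section BaerStarRing.

Variables (R : pzRingType) (star : R -> R).
Hypothesis baerR : baer_star_ring star.

Let invR : involution star := baer_involution baerR.

Lemma starK : involutive star. Proof. exact: involution_invol invR. Qed.

Lemma starM a b : star (a * b) = star b * star a.
Proof. exact: involution_mul invR _ _. Qed.

Lemma starD a b : star (a + b) = star a + star b.
Proof. exact: involution_add invR _ _. Qed.

Lemma star0 : star 0 = 0.
Proof. by apply: (@addrI _ (star 0)); rewrite -starD !addr0. Qed.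

Lemma star1 : star 1 = 1.
Proof. by rewrite -[LHS]mul1r -{1}[1]starK -starM mul1r starK. Qed.

Lemma starB a b : star (a - b) = star a - star b.
Proof.
by apply/eqP; rewrite eq_sym subr_eq -starD subrK.
Qed.

Lemma starX a n : star (a ^+ n) = star a ^+ n.
Proof.
by elim: n => [|n IHn]; rewrite ?expr0 ?star1 // exprS starM IHn exprSr.
Qed.

Lemma comm_star a b : GRing.comm a b -> GRing.comm (star a) (star b).
Proof. by rewrite /GRing.comm -!starM => ->. Qed.

Lemma projection1 : projection star 1.
Proof. by split; rewrite ?mulr1 ?star1. Qed.

Lemma projectionC e : projection star e -> projection star (1 - e).
Proof.
move=> [ee se]; split; last by rewrite starB star1 se.
by rewrite mulrBr mulr1 mulrBl mul1r ee subrr subr0.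
Qed.

Lemma projectionM e f : projection star e -> projection star f ->
  GRing.comm e f -> projection star (e * f).
Proof.
move=> [ee se] [ff sf] cef; split; last by rewrite starM se sf cef.
by rewrite mulrA -[e * f * e]mulrA -cef mulrA ee -mulrA ff.
Qed.

Lemma proj_le_sym e f : projection star e -> projection star f ->
  proj_le e f -> f * e = e.
Proof. by move=> [_ se] [_ sf] ef; rewrite -[RHS]se -[in RHS]ef starM se sf. Qed.

Lemma proj_le_anti e f : projection star e -> projection star f ->
  proj_le e f -> proj_le f e -> e = f.
Proof. by move=> pe pf ef fe; rewrite -(proj_le_sym pe pf ef). Qed.

Lemma annihilator_projection (U : set R) : exists2 f, projection star f &
  forall a, (forall s, U s -> s * a = 0) <-> f * a = a.
Proof.
have [f [pf Uf]] := baer_annihilator baerR U; exists f => // a; split=> [Ua|fa].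
  have : right_annihilator U a by [].
  by rewrite Uf => -[b _ <-]; rewrite mulrA pf.1.
have : right_annihilator U a by rewrite Uf; exists a.
by apply.
Qed.

(** The hypotheses say that the kernel of e is invariant under z and its
    adjoint; taking adjoints in the second one gives e z e = z e. *)
Lemma comm_of_invariant_kernel e z : projection star e ->
  e * z * e = e * z -> e * star z * e = e * star z -> GRing.comm e z.
Proof.
move=> [_ se] eze /(congr1 star).
by rewrite !starM starK se mulrA eze.
Qed.

(** * Left projections *)

Lemma left_projectionE e a f :
  is_left_projection star e a f -> left_projection star e a = f.
Proof.
move=> Lf; have [pf ef fa fmin] := Lf.
have [pg eg ga gmin] : is_left_projection star e a (left_projection star e a).
  exact: xgetPex (ex_intro _ f Lf).
by apply: proj_le_anti => //; [apply: gmin | apply: fmin].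
Qed.

Local Notation lproj := (left_projection star 1).

(** Minimality of [a] enters through the last clause: the Baer condition on a^*
    gives a projection g generating its right annihilator, and [a] = 1 - g. *)
Lemma lprojP a : [/\ projection star (lproj a), lproj a * a = a &
  forall b, star a * b = 0 -> lproj a * b = 0].
Proof.
have [g pg gP] := annihilator_projection [set star a].
have ga : g * a = 0.
  rewrite -[LHS]starK starM pg.2; have /gP -> // := pg.1; exact: star0.
have fker b : star a * b = 0 -> (1 - g) * b = 0.
  move=> ab; have gb : g * b = b by apply/gP => _ ->.
  by rewrite mulrBl mul1r gb subrr.
suff -> : lproj a = 1 - g.
  by split=> //; [apply: projectionC | rewrite mulrBl mul1r ga subr0].
apply: left_projectionE; split.
- exact: projectionC.
- by exists (1 - g); rewrite // mul1r mulr1.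
- by rewrite mulrBl mul1r ga subr0.
- move=> h ph _ ha; have : (1 - g) * (1 - h) = 0.
    by apply: fker; rewrite mulrBr mulr1 -ph.2 -starM ha subrr.
  exact: mulr_compl_eq0.
Qed.

(** If z commutes with a and a^*, then z and z^* preserve the right annihilator
    of a^*, which is the kernel of [a]. *)
Lemma comm_lproj z a :
  GRing.comm z a -> GRing.comm z (star a) -> GRing.comm z (lproj a).
Proof.
move=> za zsa; have [pe ea eker] := lprojP a; apply: commr_sym.
have inv w : GRing.comm w (star a) -> lproj a * w * lproj a = lproj a * w.
  move=> wsa; have : lproj a * (w * (1 - lproj a)) = 0.
    apply: eker; rewrite mulrA -wsa -mulrA mulrBr mulr1 -pe.2 -starM ea.
    by rewrite subrr mulr0.
  by rewrite mulrA => /mulr_compl_eq0.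
by apply: comm_of_invariant_kernel (inv _ zsa) (inv _ (comm_star za)).
Qed.

(** The corner e' may be larger than e: the case e' = e compares corners with R,
    and the case e' = 1 computes [e a] in R itself. *)
Lemma left_projection_compress e e' a : projection star e ->
  projection star e' -> proj_le e e' -> GRing.comm e a ->
  left_projection star e' (e * a) = e * lproj a.
Proof.
move=> pe pe' ee' ea; have [pf fa fker] := lprojP a.
have ef : GRing.comm e (lproj a).
  by apply: comm_lproj => //; rewrite -[e]pe.2; apply: comm_star.
apply: left_projectionE; split.
- exact: projectionM.
- by exists (e * lproj a); rewrite // mulrA (proj_le_sym pe) // ef -mulrA ee'.
- by rewrite mulrA -[e * _ * e]mulrA -ef mulrA pe.1 -mulrA fa.
(* g fixes e a, so (e a)^* = a^* e kills 1 - g. *)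
move=> g pg _ ga; have : lproj a * (e * (1 - g)) = 0.
  by apply: fker; rewrite mulrA -pe.2 -starM mulrBr mulr1 -pg.2 -starM ga subrr.
by rewrite mulrA -ef => /mulr_compl_eq0.
Qed.

(** * Annihilators in the commutant of a self-adjoint set *)

Definition star_commutant (S : set R) : set R :=
  [set a | forall s, S s -> GRing.comm a s /\ GRing.comm a (star s)].

Lemma star_commutant_star S a : star_commutant S a -> star_commutant S (star a).
Proof.
move=> Aa s /Aa[as_ ass]; split; last exact: comm_star.
by rewrite -[s]starK; apply: comm_star.
Qed.

Lemma star_commutantM S a b :
  star_commutant S a -> star_commutant S b -> star_commutant S (a * b).
Proof.
move=> Aa Ab s Ss; have [? ?] := Aa s Ss; have [? ?] := Ab s Ss.
by split; apply: commr_sym; apply: commrM; apply: commr_sym.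
Qed.

Lemma star_commutantC S a : star_commutant S a -> star_commutant S (1 - a).
Proof.
move=> Aa s /Aa[as_ ass]; split; apply: commr_sym; apply: commrB;
  by [exact: commr1 | apply: commr_sym].
Qed.

Lemma star_commutant_projection S e :
  projection star e -> commutant S e -> star_commutant S e.
Proof.
move=> pe Se s Ss; split; first exact: Se.
by rewrite -[e]pe.2; apply: comm_star; apply: Se.
Qed.

(** Let A be the star-commutant of S and J the set of elements of A that kill
    C.  Since C commutes with A, J absorbs multiplication by A on the right, so
    the right annihilator f R of J is invariant under A; it is invariant under
    S and its adjoints because these commute with J.  All these sets being
    self-adjoint, p = 1 - f commutes with A and with S.  Moreover C is contained
    in f R, so p kills C, while j f = 0 for j in J means j p = j. *)
Lemma largest_annihilator (S C : set R) :
  C `<=` commutant (star_commutant S) ->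
  exists p, [/\ projection star p, star_commutant S p,
    commutant (star_commutant S) p, (forall c, C c -> p * c = 0) &
    forall a, star_commutant S a -> (forall c, C c -> a * c = 0) -> a * p = a].
Proof.
move=> CA; pose J := [set a | star_commutant S a /\ forall c, C c -> a * c = 0].
have [f pf fP] := annihilator_projection J.
have Jf : forall a, J a -> a * f = 0 by apply/fP; apply: pf.1.
have inv z : (forall a, J a -> a * (z * f) = 0) ->
    (1 - f) * z * (1 - f) = (1 - f) * z.
  move/fP => fzf; rewrite mulrBr mulr1 -[_ * z * f]mulrA.
  by rewrite [(1 - f) * (z * f)]mulrBl mul1r fzf subrr subr0.
have invA z : star_commutant S z -> (1 - f) * z * (1 - f) = (1 - f) * z.
  move=> Az; apply: inv => a [Aa aC]; rewrite mulrA; apply: Jf.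
  split=> [|c Cc]; first exact: star_commutantM.
  by rewrite -mulrA -(CA c Cc z Az) mulrA aC // mul0r.
have invS z : (forall a, star_commutant S a -> GRing.comm a z) ->
    (1 - f) * z * (1 - f) = (1 - f) * z.
  move=> Sz; apply: inv => a Ja.
  by rewrite mulrA (Sz a Ja.1) -mulrA Jf // mulr0.
have pp := projectionC pf; exists (1 - f); split=> //.
- apply: star_commutant_projection => // s Ss.
  by apply: comm_of_invariant_kernel => //; apply: invS => a /(_ s Ss)[].
- move=> z Az; apply: comm_of_invariant_kernel => //; apply: invA => //.
  exact: star_commutant_star.
- move=> c Cc; have /fP fc : forall a, J a -> a * c = 0 by move=> a [_]; apply.
  by rewrite mulrBl mul1r fc subrr.
- by move=> a Aa aC; rewrite mulrBr mulr1 Jf // subr0.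
Qed.

(** In the uniqueness argument e belongs to an arbitrary second solution, so it is
    the centrality of p that makes p and 1 - e commute. *)
Lemma projection_central_diff S p e : projection star p ->
  commutant (star_commutant S) p -> projection star e -> star_commutant S e ->
  projection star (p * (1 - e)).
Proof.
move=> pp Cp pe Ae; apply: projectionM => //; first exact: projectionC.
by apply: Cp; apply: star_commutantC.
Qed.

(** * Obstructions to double commutation and to compatibility *)

Variables x y : R.

Local Notation xy := [set x; y].

Definition double_commutation_obstructions : set R :=
  [set x * y - y * x; x * star y - star y * x].

Definition compatibility_obstructions : set R :=
  [set c | exists m n : nat, [/\ (0 < m)%N, (0 < n)%N &
    c = lproj (x ^+ m) * lproj (y ^+ n) - lproj (y ^+ n) * lproj (x ^+ m)]].

Lemma star_commutant_xy z : star_commutant xy z ->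
  [/\ GRing.comm z x, GRing.comm z y, GRing.comm z (star x) &
      GRing.comm z (star y)].
Proof.
by move=> Az; have [||] := (Az x _, Az y _); [left | right | move=> [? ?] [? ?]].
Qed.

Lemma star_commutant_lproj z a m : GRing.comm z a -> GRing.comm z (star a) ->
  GRing.comm z (lproj (a ^+ m)).
Proof.
by move=> za zsa; apply: comm_lproj; rewrite ?starX; apply: commrX.
Qed.

Lemma double_commutation_obstructions_comm :
  double_commutation_obstructions `<=` commutant (star_commutant xy).
Proof.
move=> c Cc z /star_commutant_xy[zx zy zsx zsy]; apply: commr_sym.
by case: Cc => ->; apply: commrB; apply: commrM.
Qed.

Lemma compatibility_obstructions_comm :
  compatibility_obstructions `<=` commutant (star_commutant xy).
Proof.
move=> c [m [n [_ _ ->]]] z /star_commutant_xy[zx zy zsx zsy]; apply: commr_sym.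
by apply: commrB; apply: commrM; apply: star_commutant_lproj.
Qed.

Lemma comm_compress e a b : projection star e -> GRing.comm e a ->
  GRing.comm e b -> GRing.comm (e * a) (e * b) <-> e * (a * b - b * a) = 0.
Proof.
move=> pe ea eb.
have M u v : GRing.comm e u -> e * u * (e * v) = e * (u * v).
  by move=> eu; rewrite mulrA -[e * u * e]mulrA -eu mulrA pe.1 mulrA.
rewrite /GRing.comm !M // mulrBr; split=> [->|/eqP]; first exact: subrr.
by rewrite subr_eq0 => /eqP.
Qed.

Lemma doubly_commute_compress e : projection star e -> commutant xy e ->
  doubly_commute star (e * x) (e * y) <->
  forall c, double_commutation_obstructions c -> e * c = 0.
Proof.
move=> pe /(star_commutant_projection pe) /star_commutant_xy[ex ey esx esy].
rewrite /doubly_commute starM pe.2 -esy !comm_compress //.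
split=> [[c1 c2] c [->|->] //|C].
by split; apply: C; [left | right].
Qed.

Lemma compress_exp e a m : projection star e -> GRing.comm e a -> (0 < m)%N ->
  (e * a) ^+ m = e * a ^+ m.
Proof.
move=> pe ea; case: m => // m _; rewrite exprMn_comm //; congr (_ * _).
by elim: m => // m IHm; rewrite exprS IHm pe.1.
Qed.

Lemma compatible_compress e : projection star e -> commutant xy e ->
  compatible star e (e * x) (e * y) <->
  forall c, compatibility_obstructions c -> e * c = 0.
Proof.
move=> pe /(star_commutant_projection pe) /star_commutant_xy[ex ey esx esy].
have step m n : (0 < m)%N -> (0 < n)%N ->
    GRing.comm (left_projection star e ((e * x) ^+ m))
               (left_projection star e ((e * y) ^+ n)) <->
    e * (lproj (x ^+ m) * lproj (y ^+ n) - lproj (y ^+ n) * lproj (x ^+ m)) = 0.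
  move=> m0 n0; have ee : proj_le e e := pe.1.
  rewrite !compress_exp // !left_projection_compress //; try exact: commrX.
  by apply: comm_compress => //; apply: star_commutant_lproj.
split=> [H _ [m [n [m0 n0 ->]]]|H m n m0 n0].
  by apply/step => //; apply: H.
by apply/step => //; apply: H; exists m, n.
Qed.

(** When u = e x and v = e y doubly commute, v and v^* commute with u and u^*,
    hence with the left projection of u^m in R; so this projection commutes with
    that of v^n.  These two are the compressions to e of [x^m] and [y^n]. *)
Lemma doubly_commuting_compatible e : projection star e -> commutant xy e ->
  (forall c, double_commutation_obstructions c -> e * c = 0) ->
  forall c, compatibility_obstructions c -> e * c = 0.
Proof.
move=> pe ce /(doubly_commute_compress pe ce)[uv usv] _ [m [n [m0 n0 ->]]].
have /star_commutant_xy[ex ey esx esy] := star_commutant_projection pe ce.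
have e1 : proj_le e 1 by rewrite /proj_le mulr1.
apply/comm_compress; try exact: star_commutant_lproj.
  by [].
rewrite -(left_projection_compress pe projection1 e1 (commrX m ex)).
rewrite -(left_projection_compress pe projection1 e1 (commrX n ey)).
rewrite -!compress_exp //; apply: star_commutant_lproj; apply: commr_sym.
  apply: star_commutant_lproj; first exact: commr_sym.
  by rewrite -[e * y]starK; apply: comm_star; apply: commr_sym.
apply: star_commutant_lproj; first exact: commr_sym.
by apply: comm_star; apply: commr_sym.
Qed.

(** Since e commutes with x and y, r x = r e x = e x r = x r: below e, commuting
    with the compressed pair is the same as commuting with the pair itself. *)
Lemma star_commutant_subprojection e r : projection star e ->
  star_commutant xy e -> projection star r -> proj_le r e ->
  GRing.comm r (e * x) -> GRing.comm r (e * y) -> star_commutant xy r.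
Proof.
move=> pe /star_commutant_xy[ex ey _ _] pr re rex rey.
have er := proj_le_sym pr pe re.
have sub a : GRing.comm e a -> GRing.comm r (e * a) -> GRing.comm r a.
  by move=> ea; rewrite /GRing.comm mulrA re ea -mulrA er.
by apply: star_commutant_projection => // s [->|->]; apply: sub.
Qed.

(** The test projections r become projections of the star-commutant killing the
    obstructions, the form in which maximality of p and q can be compared. *)
Lemma completely_non_doubly_commutingP e :
  projection star e -> star_commutant xy e ->
  completely_non_doubly_commuting star e x y <->
  forall r, projection star r -> star_commutant xy r -> proj_le r e ->
    (forall c, double_commutation_obstructions c -> r * c = 0) -> r = 0.
Proof.
move=> pe Ae; split=> [H r pr Ar re rD|H r pr r0 re rex rey].
  have Sr : commutant xy r by move=> s /Ar[].
  have cre : GRing.comm r e by rewrite /GRing.comm re (proj_le_sym pr pe).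
  apply: contrapT => r0; apply: (H r pr r0 re); last first.
  - exact/doubly_commute_compress.
  - by apply: commrM => //; apply: Sr; right.
  - by apply: commrM => //; apply: Sr; left.
have Ar := star_commutant_subprojection pe Ae pr re rex rey.
have Sr : commutant xy r by move=> s /Ar[].
by move=> /(doubly_commute_compress pr Sr) /(H r pr Ar re).
Qed.

Lemma completely_non_compatibleP e :
  projection star e -> star_commutant xy e ->
  completely_non_compatible star e x y <->
  forall r, projection star r -> star_commutant xy r -> proj_le r e ->
    (forall c, compatibility_obstructions c -> r * c = 0) -> r = 0.
Proof.
move=> pe Ae; split=> [H r pr Ar re rC|H r pr r0 re rex rey].
  have Sr : commutant xy r by move=> s /Ar[].
  have cre : GRing.comm r e by rewrite /GRing.comm re (proj_le_sym pr pe).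
  apply: contrapT => r0; apply: (H r pr r0 re); last first.
  - exact/compatible_compress.
  - by apply: commrM => //; apply: Sr; right.
  - by apply: commrM => //; apply: Sr; left.
have Ar := star_commutant_subprojection pe Ae pr re rex rey.
have Sr : commutant xy r by move=> s /Ar[].
by move=> /(compatible_compress pr Sr) /(H r pr Ar re).
Qed.

End BaerStarRing.

Theorem theorem3p7 (R : pzRingType) (star : R -> R)
    (hR : baer_star_ring star) (x y : R) :
  exists! pq : R * R, let: (p, q) := pq in
    [/\ [/\ projection star p, projection star q,
            commutant [set x; y] p, commutant [set x; y] q & proj_le p q],
        doubly_commute star (p * x) (p * y),
        compatible star (q * (1 - p)) (q * (1 - p) * x) (q * (1 - p) * y) /\
          completely_non_doubly_commuting star (q * (1 - p)) x y &
        completely_non_compatible star (1 - q) x y].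
Proof.
have [p [pp Ap Cp pD pmax]] :=
  largest_annihilator hR (@double_commutation_obstructions_comm R star x y).
have [q [pq Aq Cq qC qmax]] :=
  largest_annihilator hR (@compatibility_obstructions_comm R star hR x y).
have Sp : commutant [set x; y] p by move=> s /Ap[].
have Sq : commutant [set x; y] q by move=> s /Aq[].
have C1 := projectionC hR.
have pC := doubly_commuting_compatible hR pp Sp pD.
have ple : proj_le p q by exact: qmax.
exists (p, q); split=> [|[p' q'] [[pp' pq' Sp' Sq' p'q'] p'D [q'C cnd] cnc]].
  have pe := projection_central_diff hR pq Cq pp Ap.
  have Ae := star_commutantM Aq (star_commutantC Ap).
  split; [by split | exact/doubly_commute_compress | split |].
  - apply/compatible_compress => // [s /Ae[] // | c /qC qc0].
    by rewrite (Cq _ (star_commutantC Ap)) -mulrA qc0 mulr0.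
  - apply/completely_non_doubly_commutingP => // r pr Ar re /(pmax r Ar) rp.
    by rewrite -rp -re -!mulrA mulrBl mul1r pp.1 subrr !mulr0.
  - apply/(completely_non_compatibleP hR (C1 _ pq) (star_commutantC Aq)).
    move=> r pr Ar re /(qmax r Ar) rq.
    by rewrite -rq -re -mulrA mulrBl mul1r pq.1 subrr mulr0.
have Ap' := star_commutant_projection hR pp' Sp'.
have Aq' := star_commutant_projection hR pq' Sq'.
have Ae' := star_commutantM Aq' (star_commutantC Ap').
have q'p' := proj_le_sym hR pp' pq' p'q'.
have pe' : projection star (q' * (1 - p')).
  apply: projectionM => //; first exact: C1.
  by rewrite /GRing.comm mulrBr mulrBl mulr1 mul1r q'p' p'q'.
have {}cnc :=
  (completely_non_compatibleP hR (C1 _ pq') (star_commutantC Aq')).1 cnc.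
have {}cnd := (completely_non_doubly_commutingP hR pe' Ae').1 cnd.
have {}p'D := (doubly_commute_compress hR pp' Sp').1 p'D.
have Se' : commutant [set x; y] (q' * (1 - p')) by move=> s /Ae'[].
have {}q'C := (compatible_compress hR pe' Se').1 q'C.
have diff_le a b : projection star b -> proj_le (a * (1 - b)) (1 - b).
  by move=> pb; rewrite /proj_le -mulrA (C1 _ pb).1.
have diff_kill a b c : GRing.comm a (1 - b) -> a * c = 0 -> a * (1 - b) * c = 0.
  by move=> -> ac; rewrite -mulrA ac mulr0.
(* p (1 - q') lies below 1 - q' and kills the obstructions to compatibility. *)
have pq'le : proj_le p q'.
  apply: mulr_compl_eq0; apply: cnc.
  - exact: projection_central_diff Cp pq' Aq'.
  - exact: star_commutantM Ap (star_commutantC Aq').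
  - exact: diff_le.
  - by move=> c /pC; apply: diff_kill; apply: Cp; apply: star_commutantC.
have p'C := Cp _ (star_commutantC Ap').
(* Now p - p' = p (1 - p') lies below q' (1 - p'), as p <= q'. *)
have pp'le : proj_le p p'.
  apply: mulr_compl_eq0; apply: cnd.
  - exact: projection_central_diff Cp pp' Ap'.
  - exact: star_commutantM Ap (star_commutantC Ap').
  - rewrite /proj_le mulrA p'C -(mulrA _ p) pq'le -mulrA p'C mulrA.
    by rewrite (C1 _ pp').1 -p'C.
  - by move=> c /pD; apply: diff_kill.
have {pp'le} pE : p = p'.
  by apply: (proj_le_anti hR) => //; apply: pmax.
rewrite -{}pE in q'C *; congr pair; apply: (proj_le_anti hR) => //.
  apply: mulr_compl_eq0; apply: cnc.
  - exact: projection_central_diff Cq pq' Aq'.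
  - exact: star_commutantM Aq (star_commutantC Aq').
  - exact: diff_le.
  - by move=> c /qC; apply: diff_kill; apply: Cq; apply: star_commutantC.
(* q' = p + q' (1 - p), and both summands kill c. *)
apply: qmax => // c Cc; have := q'C c Cc.
by rewrite mulrBr mulr1 mulrBl -mulrA pC // mulr0 subr0.
Qed.
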